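(* Let $G=(A\cup B,E)$ be a bipartite graph in which every node has a strict ranking of its neighbors. Let $M$ be a popular max-matching in $G$, let $U$ be the set of nodes left unmatched by $M$, $U_A=U\cap A$, $U_B=U\cap B$, $A'=A\setminus U$, $B'=B\setminus U$, and $n_0=|A'|=|B'|$. Let $E'$ be the edge set of the subgraph of $G$ induced on $(A\cup B)\setminus U$, and consider the linear program $$\min\sum_{u\in (A\cup B)\setminus U} y_u\quad\text{s.t.}\quad y_a+y_b\ge\mathsf{wt}_M(a,b)\ \ \forall (a,b)\in E'.$$ There exists an optimal solution $\vec\alpha$ of this program with $\alpha_a\in\{0,-2,\ldots,-2(n_0-1)\}$ for all $a\in A'$ and $\alpha_b\in\{0,2,\ldots,2(n_0-1)\}$ for all $b\in B'$ such that (i) $\alpha_a=0$ for all $a\in\mathsf{Nbr}(U_B)$ and (ii) $\alpha_b=2(n_0-1)$ for all $b\in\mathsf{Nbr}(U_A)$.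
   Context: Node $u$ prefers matching $M$ to $N$ if $u$ is matched in $M$ and unmatched in $N$, or matched in both and prefers its partner in $M$. $\phi(M,N)$ is the number of nodes preferring $M$ to $N$, $\Delta(M,N)=\phi(M,N)-\phi(N,M)$. A maximum matching $M$ is a popular max-matching if $\Delta(M,N)\ge0$ for all maximum matchings $N$ of $G$. An edge $(a,b)$ blocks $M$ if each of $a,b$ is unmatched in $M$ or prefers the other to its partner in $M$. $\mathsf{wt}_M(a,b)=2$ if $(a,b)$ blocks $M$; $-2$ if $a$ and $b$ both prefer their assignments in $M$ to each other; $0$ otherwise. For $T\subseteq A\cup B$, $\mathsf{Nbr}(T)$ is the set of neighbors in $G$ of nodes in $T$. *)

(* Defs.v *)
From mathcomp Require Import all_boot all_order all_algebra.

Set Implicit Arguments.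
Unset Strict Implicit.
Unset Printing Implicit Defensive.

Import GRing.Theory Num.Theory.
Local Open Scope ring_scope.

(* The node set A :|: B is the whole of V, so that B is the complement of A.
   An edge is stored once, as the ordered pair (a, b) with a in A, b in B.
   [pref u v w] means that u strictly prefers v to w; it is only constrained
   (to be a strict linear order) on the neighbors of u. *)
Record pref_bigraph (V : finType) := PrefBigraph {
  sideA : {set V};
  edges : {set V * V};
  pref : V -> rel V;
  sideB := ~: sideA;
  adj := fun u v => ((u, v) \in edges) || ((v, u) \in edges);
  edges_sub : edges \subset setX sideA sideB;
  pref_irr : forall u v, adj u v -> ~~ pref u v v;
  pref_trans : forall u v w x, adj u v -> adj u w -> adj u x ->
    pref u v w -> pref u w x -> pref u v x;
  pref_total : forall u v w, adj u v -> adj u w ->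
    v != w -> pref u v w || pref u w v
}.

Section Defs.
Variables (V : finType) (G : pref_bigraph V).
Implicit Types (M N : {set V * V}) (T : {set V}) (u v a b : V).

Definition Nbr T : {set V} := [set v | [exists u in T, adj G u v]].

Definition incident u (e : V * V) := (u == e.1) || (u == e.2).

Definition is_matching M : Prop :=
  M \subset edges G /\
  forall e f u, e \in M -> f \in M -> incident u e -> incident u f -> e = f.

Definition is_max_matching M : Prop :=
  is_matching M /\ forall N, is_matching N -> (#|N| <= #|M|)%N.

Definition partner M u : option V :=
  [pick v | ((u, v) \in M) || ((v, u) \in M)].

Definition unmatched M : {set V} := [set u | partner M u == None].

Definition prefers_matching u M N : bool :=
  match partner M u, partner N u with
  | Some v, Some w => pref G u v w
  | Some _, None => true
  | None, _ => false
  end.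

Definition phi M N : nat := #|[set u | prefers_matching u M N]|.

Definition Delta M N : int := (phi M N)%:Z - (phi N M)%:Z.

Definition popular_max_matching M : Prop :=
  is_max_matching M /\ forall N, is_max_matching N -> 0 <= Delta M N.

Definition prefers_to_assignment M u v : bool :=
  if partner M u is Some w then pref G u v w else true.

Definition prefers_assignment M u v : bool :=
  if partner M u is Some w then pref G u w v else false.

Definition blocks M a b : bool :=
  [&& (a, b) \in edges G, prefers_to_assignment M a b
    & prefers_to_assignment M b a].

Definition wt M a b : int :=
  if blocks M a b then 2
  else if prefers_assignment M a b && prefers_assignment M b a then - 2
  else 0.

Definition induced_edges T : {set V * V} :=
  [set e in edges G | (e.1 \in T) && (e.2 \in T)].

Section LP.
Variable R : realFieldType.

(* The variables of the linear program are the y u with u matched by M; the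
   values of y at unmatched nodes occur nowhere below. *)
Definition lp_objective M (y : V -> R) : R := \sum_(u in ~: unmatched M) y u.

Definition lp_feasible M (y : V -> R) : Prop :=
  forall a b, (a, b) \in induced_edges (~: unmatched M) ->
    (wt M a b)%:~R <= y a + y b.

Definition lp_optimal M (y : V -> R) : Prop :=
  lp_feasible M y /\
  forall z, lp_feasible M z -> lp_objective M y <= lp_objective M z.

End LP.

Lemma edges_side e : e \in edges G -> (e.1 \in sideA G) && (e.2 \notin sideA G).
Proof.
by move=> eE; have /subsetP/(_ _ eE) := edges_sub G; rewrite !inE.
Qed.

Lemma matchedP M u :
  reflect (exists2 e, e \in M & incident u e) (u \notin unmatched M).
Proof.
rewrite inE /partner; apply: (iffP idP).
  case: pickP => // v /orP[] vM _; first by exists (u, v); rewrite /incident ?eqxx.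
  by exists (v, u); rewrite /incident ?eqxx ?orbT.
case=> -[a b] eM ue; case: pickP => // nM; exfalso.
by case/orP: ue => /= /eqP eu; [have := nM b | have := nM a];
  rewrite eu eM ?orbT.
Qed.

(* Both sides have the same number of matched nodes, so that n_0 is
   well defined. *)
Lemma card_matched_sides M : is_matching M ->
  #|sideA G :\: unmatched M| = #|sideB G :\: unmatched M|.
Proof.
case=> /subsetP ME inj.
have -> : sideA G :\: unmatched M = fst @: M.
  apply/setP => u; rewrite in_setD; apply/andP/imsetP => [[/matchedP[e eM ue] uA]|].
    exists e => //; case/orP: ue => /eqP // ue.
    by move: (edges_side (ME _ eM)); rewrite -ue uA andbF.
  case=> e eM ->; have /andP[-> _] := edges_side (ME _ eM); split=> //.
  by apply/matchedP; exists e; rewrite /incident ?eqxx.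
have -> : sideB G :\: unmatched M = snd @: M.
  apply/setP => u; rewrite in_setD in_setC; apply/andP/imsetP => [[/matchedP[e eM ue] uA]|].
    exists e => //; case/orP: ue => /eqP // ue.
    by move: (edges_side (ME _ eM)); rewrite -ue (negPf uA).
  case=> e eM ->; have /andP[_ ->] := edges_side (ME _ eM); split=> //.
  by apply/matchedP; exists e; rewrite /incident ?eqxx ?orbT.
by rewrite !card_in_imset // => e f eM fM ef;
  [apply: (inj e f e.2) | apply: (inj e f e.1)];
  rewrite // /incident ?ef ?eqxx ?orbT.
Qed.

End Defs.

(* Main.v *)
Require Import Defs.
From mathcomp Require Import all_boot all_order all_algebra zify.

Set Implicit Arguments.
Unset Strict Implicit.
Unset Printing Implicit Defensive.

Import GRing.Theory Num.Theory.
Local Open Scope ring_scope.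

(* Consider the digraph on A' with an arc a -> a' whenever a is adjacent to the
   M-partner of a', weighted by half of wt_M on that edge. Exchanging M along a
   simple cycle, along a simple path ending next to U_B, or along one starting
   next to U_A yields another maximum matching, so popularity of M makes all of
   these weights at most 0; a path from Nbr(U_A) to Nbr(U_B) would be augmenting.
   Hence p(f) := max over simple paths x -> ... -> f of s(x) + weight, where
   s(x) = n0 - 1 if the partner of x is in Nbr(U_A) and s(x) = 0 otherwise, is a
   potential with values in {0, ..., n0 - 1}. Setting alpha = -2 p on A' and
   alpha = 2 p(partner) on B' gives a feasible solution of value 0, which is
   optimal because wt_M vanishes on M. *)

(** * Longest simple paths *)

Definition path_weight (T : Type) (c : T -> T -> int) (x : T) (q : seq T) : int :=
  \sum_(z <- pairmap c x q) z.

Section LongestPaths.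
Variables (T : finType) (S S0 S1 : {set T}) (arc : rel T) (c : T -> T -> int).
Implicit Types (x y f : T) (q : seq T).

Local Notation weight := (path_weight c).

Lemma path_weight_cat x q1 q2 :
  weight x (q1 ++ q2) = weight x q1 + weight (last x q1) q2.
Proof. by rewrite /path_weight pairmap_cat big_cat. Qed.

Lemma path_weight_nil x : weight x [::] = 0.
Proof. exact: big_nil. Qed.

Lemma path_weight_cons x y q : weight x (y :: q) = c x y + weight y q.
Proof. by rewrite /path_weight /= big_cons. Qed.

Lemma path_weight_rcons x q y : weight x (rcons q y) = weight x q + c (last x q) y.
Proof. by rewrite -cats1 path_weight_cat /path_weight /= big_seq1. Qed.

Definition simple_path x q := path arc x q && uniq (x :: q).

(** In the application [S] is $A'$, [S0] is $\mathsf{Nbr}(U_B)$ and [S1] is the set of partners of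
    $\mathsf{Nbr}(U_A)$. *)
Hypothesis c_le1 : forall x y, c x y <= 1.
Hypothesis arcS : forall x y, arc x y -> (x \in S) && (y \in S).
Hypothesis cycle_le0 : forall x q, simple_path x q -> arc (last x q) x ->
  weight x q + c (last x q) x <= 0.
Hypothesis S1_le0 : forall x q, x \in S1 -> simple_path x q -> weight x q <= 0.
Hypothesis S0_le0 : forall x q, x \in S -> last x q \in S0 -> simple_path x q ->
  weight x q <= 0.
Hypothesis S1_S0 : forall x q, x \in S1 -> simple_path x q -> last x q \notin S0.
Hypotheses (S0S : S0 \subset S) (S1S : S1 \subset S).

(** This bonus is the largest value allowed for the potential, so it forces that value on [S1]
    already through the empty path. *)
Let start x : int := if x \in S1 then (#|S|.-1)%:Z else 0.

Lemma simple_path_size x q : x \in S -> simple_path x q -> (size q < #|S|)%N.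
Proof.
move=> xS /andP[pq uq]; rewrite -[(size q).+1]/(size (x :: q)).
rewrite -(card_uniqP uq); apply: subset_leq_card; apply/subsetP => y.
rewrite inE => /predU1P[-> //|].
elim: q x pq {xS uq} => //= z q IH x /andP[/arcS/andP[_ zS] pq].
by rewrite inE => /predU1P[-> //|]; apply: IH pq.
Qed.

Lemma path_weight_size x q : weight x q <= (size q)%:Z.
Proof.
elim: q x => [|y q IH] x; first by rewrite path_weight_nil.
by rewrite path_weight_cons /=; have := IH y; have := c_le1 x y; lia.
Qed.

(** Bounding the length by [#|T|] makes the quantifier range over a finite type, so the predicate is
    boolean; simple paths satisfy the bound anyway. *)
Definition attains f (k : nat) := [exists x in S, exists q : {bseq #|T| of T},
  [&& simple_path x q, last x q == f & start x + weight x q == k%:Z]].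

Lemma attainsP f (k : nat) : reflect
  (exists x q, [/\ x \in S, simple_path x q, last x q = f & start x + weight x q = k%:Z])
  (attains f k).
Proof.
apply: (iffP exists_inP) => [[x xS /existsP[q /and3P[sp /eqP lq /eqP wq]]]|].
  by exists x, q.
case=> x [q [xS sp lq wq]]; exists x => //.
have sq : (size q <= #|T|)%N.
  by apply: leq_trans (max_card (mem S)); apply/ltnW/simple_path_size/sp.
by apply/existsP; exists (Bseq sq); rewrite /= sp lq wq !eqxx.
Qed.

(** From [S1] the weight adds nothing to the bonus; from elsewhere there is no bonus, and a simple
    path inside [S] has at most [#|S|.-1] arcs, each of weight at most 1. *)
Lemma start_weight_le x q : x \in S -> simple_path x q ->
  start x + weight x q <= (#|S|.-1)%:Z.
Proof.
rewrite /start => xS sp; case: ifP => xS1.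
  by have := S1_le0 xS1 sp; lia.
by have := path_weight_size x q; have := simple_path_size xS sp; lia.
Qed.

Lemma attains_le f k : attains f k -> (k <= #|S|.-1)%N.
Proof.
by case/attainsP=> x [q [xS sp _ wq]]; have := start_weight_le xS sp; lia.
Qed.

Lemma attains_start f : f \in S -> attains f (if f \in S1 then #|S|.-1 else 0%N).
Proof.
move=> fS; apply/attainsP; exists f, [::]; split=> //.
by rewrite path_weight_nil addr0 /start; case: ifP.
Qed.

(** Restricting to [k < #|S|] and to natural numbers loses nothing: [attains_le] bounds all values,
    and the empty path already gives a nonnegative one. *)
Definition longest_path f : nat := \max_(k < #|S| | attains f k) k.

Lemma longest_path_attains f : f \in S -> attains f (longest_path f).
Proof.
move=> fS; have af := attains_start fS.
have kS : ((if f \in S1 then #|S|.-1 else 0) < #|S|)%N.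
  by have := attains_le af; have := simple_path_size fS (isT : simple_path f [::]); lia.
have [|j aj mj] := @eq_bigmax_cond _ [pred k : 'I_#|S| | attains f k] (@nat_of_ord _).
  by apply/card_gt0P; exists (Ordinal kS).
by rewrite /longest_path mj.
Qed.

Lemma longest_path_max f x q : x \in S -> simple_path x q -> last x q = f ->
  start x + weight x q <= (longest_path f)%:Z.
Proof.
move=> xS sp lq; have le := start_weight_le xS sp.
(* A negative total lies below every natural number; a nonnegative one is among the indices of the
   maximum. *)
have [w0|] := lerP 0 (start x + weight x q); last by lia.
have jS : (absz (start x + weight x q)%R < #|S|)%N.
  by have := simple_path_size xS sp; lia.
suff af : attains f (Ordinal jS).
  suff : (Ordinal jS <= longest_path f)%N by rewrite /=; lia.
  exact: leq_bigmax_cond.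
by apply/attainsP; exists x, q; split=> //=; rewrite gez0_abs.
Qed.

(* A longest simple path to [x] either extends to [y], or already visits [y];
   in that case the part after [y] closes up to a simple cycle, of weight at
   most 0, and the part before [y] competes for [y]. *)
Lemma longest_path_arc x y : arc x y ->
  (longest_path x)%:Z + c x y <= (longest_path y)%:Z.
Proof.
move=> xy; have /andP[xS yS] := arcS xy.
have /attainsP[z [q [zS sp lq <-]]] := longest_path_attains xS.
have [yq|yq] := boolP (y \in z :: q); last first.
  have := @longest_path_max y z (rcons q y) zS.
  rewrite last_rcons path_weight_rcons lq addrA; apply=> //.
  case/andP: sp => pq uq; rewrite /simple_path rcons_path pq lq xy.
  by rewrite -rcons_cons rcons_uniq yq.
case/splitPl: yq sp lq => q1 q2 lq1; rewrite /simple_path last_cat lq1.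
rewrite cat_path lq1 -cat_cons cat_uniq => /andP[/andP[p1 p2] /and3P[u1 u12 u2]] lq.
have sp2 : simple_path y q2.
  rewrite /simple_path p2 /= u2 andbT; apply: contra u12 => yq2.
  by apply/hasP; exists y => //; rewrite -lq1 mem_last.
have sp1 : simple_path z q1 by rewrite /simple_path p1.
have := cycle_le0 sp2; rewrite lq => /(_ xy) le0.
have le1 := longest_path_max zS sp1 lq1.
by rewrite path_weight_cat lq1; clear - le0 le1; lia.
Qed.

(** On [S1] the empty path attains the upper bound. A path ending in [S0] cannot start in [S1], so
    it gets no bonus and its weight is at most 0. *)
Lemma longest_path_potential : exists p : T -> nat,
  [/\ forall x, x \in S -> (p x < #|S|)%N,
      forall x y, arc x y -> (p x)%:Z + c x y <= (p y)%:Z,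
      forall x, x \in S1 -> p x = #|S|.-1
    & forall x, x \in S0 -> p x = 0%N].
Proof.
exists longest_path; split=> [x xS|||].
- have := attains_le (longest_path_attains xS).
  by have := simple_path_size xS (isT : simple_path x [::]); lia.
- exact: longest_path_arc.
- move=> x xS1; have xS := subsetP S1S x xS1.
  have := attains_le (longest_path_attains xS).
  have := longest_path_max xS (isT : simple_path x [::]) erefl.
  rewrite /start xS1 path_weight_nil addr0 lez_nat => le1 le2.
  by apply/eqP; rewrite eqn_leq le1 le2.
- move=> x xS0; have xS := subsetP S0S x xS0.
  have /attainsP[z [q [zS sp lq]]] := longest_path_attains xS.
  rewrite /start; case: ifP => [zS1|_]; first by have := S1_S0 zS1 sp; rewrite lq xS0.
  by have := S0_le0 zS _ sp; rewrite lq => /(_ xS0); lia.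
Qed.

End LongestPaths.

(** * Matchings and votes *)

Lemma uniq_map_inj (T1 T2 : eqType) (f : T1 -> T2) (s : seq T1) :
  uniq (map f s) -> {in s &, injective f}.
Proof.
elim: s => //= x s IH /andP[xs us] y z; rewrite !inE.
case/predU1P=> [->|ys] /predU1P[->|zs] // eq_f.
- by rewrite eq_f map_f in xs.
- by rewrite -eq_f map_f in xs.
- exact: IH eq_f.
Qed.

Section Matchings.
Variables (V : finType) (G : pref_bigraph V).
Implicit Types (M N : {set V * V}) (u v a b : V) (e f : V * V).

(** A total form of [partner]; the value [u] at an unmatched node is a dummy. *)
Definition mate M u : V := odflt u (partner M u).

Lemma edge_side1 e : e \in edges G -> e.1 \in sideA G.
Proof. by case/edges_side/andP. Qed.

Lemma edge_side2 e : e \in edges G -> e.2 \notin sideA G.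
Proof. by case/edges_side/andP. Qed.

(** Bipartiteness rules out a node that is the first endpoint of one edge and the second endpoint of
    another, so each projection can be treated separately. *)
Lemma is_matchingI M : M \subset edges G ->
  {in M &, injective fst} -> {in M &, injective snd} -> is_matching G M.
Proof.
move=> ME inj1 inj2; split=> // e f u eM fM.
have /edge_side1 e1 := subsetP ME _ eM; have /edge_side2 e2 := subsetP ME _ eM.
have /edge_side1 f1 := subsetP ME _ fM; have /edge_side2 f2 := subsetP ME _ fM.
case/orP=> /eqP ue /orP[] /eqP uf; rewrite uf in ue.
- exact/inj1.
- by rewrite -ue (negPf f2) in e1.
- by rewrite -ue f1 in e2.
- exact/inj2.
Qed.

Section OneMatching.
Variable M : {set V * V}.
Hypothesis hM : is_matching G M.

Lemma matching_edge e : e \in M -> e \in edges G.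
Proof. exact/subsetP/hM.1. Qed.

Lemma matching_inj1 : {in M &, injective fst}.
Proof. by move=> e f eM fM ef; apply: (hM.2 _ _ e.1); rewrite // /incident ?ef eqxx. Qed.

Lemma matching_inj2 : {in M &, injective snd}.
Proof.
by move=> e f eM fM ef; apply: (hM.2 _ _ e.2); rewrite // /incident ?ef eqxx orbT.
Qed.

Lemma matched1 e : e \in M -> e.1 \notin unmatched M.
Proof. by move=> eM; apply/matchedP; exists e; rewrite // /incident eqxx. Qed.

Lemma matched2 e : e \in M -> e.2 \notin unmatched M.
Proof. by move=> eM; apply/matchedP; exists e; rewrite // /incident eqxx orbT. Qed.

Lemma partner1 e : e \in M -> partner M e.1 = Some e.2.
Proof.
case: e => a b /= eM; rewrite /partner; case: pickP => [v /orP[] vM|/(_ b)].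
- by have [<-] := matching_inj1 vM eM erefl.
- have := edge_side2 (matching_edge vM); have := edge_side1 (matching_edge eM).
  by rewrite /= => ->.
- by rewrite eM.
Qed.

Lemma partner2 e : e \in M -> partner M e.2 = Some e.1.
Proof.
case: e => a b /= eM; rewrite /partner; case: pickP => [v /orP[] vM|/(_ a)].
- have := edge_side2 (matching_edge eM); have := edge_side1 (matching_edge vM).
  by rewrite /= => ->.
- by have [<-] := matching_inj2 vM eM erefl.
- by rewrite eM orbT.
Qed.

Lemma mate1 e : e \in M -> mate M e.1 = e.2.
Proof. by rewrite /mate => /partner1 ->. Qed.

Lemma mate2 e : e \in M -> mate M e.2 = e.1.
Proof. by rewrite /mate => /partner2 ->. Qed.

Lemma mateA a : a \in sideA G :\: unmatched M -> (a, mate M a) \in M.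
Proof.
case/setDP=> aA /matchedP[[x y] eM /orP[] /= /eqP ae].
  by rewrite ae (mate1 eM).
by have := edge_side2 (matching_edge eM); rewrite /= -ae aA.
Qed.

Lemma mateB b : b \in sideB G :\: unmatched M -> (mate M b, b) \in M.
Proof.
case/setDP; rewrite inE => bA /matchedP[[x y] eM /orP[] /= /eqP ae].
  by have := edge_side1 (matching_edge eM); rewrite /= -ae (negPf bA).
by rewrite ae (mate2 eM).
Qed.

(** The two projections map the matching bijectively onto the matched nodes of each side. This
    serves both the objective of the program and the count of votes. *)
Lemma sum_matched (R : nmodType) (y : V -> R) :
  \sum_(u in ~: unmatched M) y u = \sum_(e in M) (y e.1 + y e.2).
Proof.
rewrite (bigID [in sideA G]) big_split /=; congr (_ + _).
  rewrite -(big_imset _ matching_inj1); apply: eq_bigl => u; rewrite in_setC.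
  apply/andP/imsetP => [[uU uA]|[e eM ->]]; last first.
    by rewrite matched1 // edge_side1 // matching_edge.
  by exists (u, mate M u) => //; apply: mateA; rewrite inE uU.
rewrite -(big_imset _ matching_inj2); apply: eq_bigl => u; rewrite in_setC.
apply/andP/imsetP => [[uU uA]|[e eM ->]]; last first.
  by rewrite matched2 // edge_side2 // matching_edge.
by exists (mate M u, u) => //; apply: mateB; rewrite !inE uA andbT; rewrite inE in uU.
Qed.

End OneMatching.
End Matchings.

Section Votes.
Variables (V : finType) (G : pref_bigraph V) (M : {set V * V}).
Hypothesis hM : is_matching G M.
Implicit Types (N : {set V * V}) (u v a b : V) (e f : V * V).

(** This is the contribution of [u] to $\phi(N,M)-\phi(M,N)$ when $N$ matches [u] to [v]. *)
Definition vote u v : int :=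
  (prefers_to_assignment G M u v)%:Z - (prefers_assignment G M u v)%:Z.

Lemma pref_asym u v w : adj G u v -> adj G u w -> v != w ->
  pref G u w v = ~~ pref G u v w.
Proof.
move=> uv uw vw; have := pref_total uv uw vw.
case vw1: (pref G u v w); case wv1: (pref G u w v) => //.
by have := pref_irr uv; rewrite (pref_trans uv uw uv vw1 wv1).
Qed.

Lemma partner_adj u v : partner M u = Some v -> adj G u v.
Proof.
rewrite /partner; case: pickP => // w uw [<-]; rewrite /adj.
by case/orP: uw => /(matching_edge hM) ->; rewrite ?orbT.
Qed.

Lemma partner_self u v : partner M u = Some v ->
  prefers_to_assignment G M u v = false /\ prefers_assignment G M u v = false.
Proof.
move=> uv; rewrite /prefers_to_assignment /prefers_assignment uv.
by have /negPf -> := pref_irr (partner_adj uv).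
Qed.

Lemma prefers_assignmentN u v : adj G u v -> partner M u != Some v ->
  prefers_assignment G M u v = ~~ prefers_to_assignment G M u v.
Proof.
rewrite /prefers_to_assignment /prefers_assignment => uv.
case uw: (partner M u) => [w|] // ne; apply: pref_asym => //.
  exact: partner_adj.
by apply: contraNneq ne => ->.
Qed.

Lemma wt_matching e : e \in M -> wt G M e.1 e.2 = 0.
Proof.
move=> eM; have [p1 p2] := partner_self (partner1 hM eM).
by rewrite /wt /blocks p1 p2 andbF.
Qed.

(** On [M] both votes are 0. Off [M] strictness makes each vote 1 or -1, and the three possible sums
    are the three cases of [wt]. *)
Lemma vote_wt e : e \in edges G -> vote e.1 e.2 + vote e.2 e.1 = wt G M e.1 e.2.
Proof.
move=> eE; have [eM|eM] := boolP (e \in M).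
  rewrite wt_matching // /vote.
  have [-> ->] := partner_self (partner1 hM eM).
  by have [-> ->] := partner_self (partner2 hM eM).
have ad1 : adj G e.1 e.2 by rewrite /adj -surjective_pairing eE.
have ad2 : adj G e.2 e.1 by rewrite /adj -surjective_pairing eE orbT.
have np1 : partner M e.1 != Some e.2.
  apply: contra eM => /eqP p1; case: e eE p1 {ad1 ad2} => a b /= eE.
  rewrite /partner; case: pickP => // w uw [bw]; rewrite bw in uw.
  case/orP: uw => // /(matching_edge hM)/edge_side2 /=.
  by rewrite (edge_side1 eE).
have np2 : partner M e.2 != Some e.1.
  apply: contra eM => /eqP p1; case: e eE p1 {ad1 ad2 np1} => a b /= eE.
  rewrite /partner; case: pickP => // w uw [bw]; rewrite bw in uw.
  case/orP: uw => // /(matching_edge hM)/edge_side1 /=.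
  by rewrite (negPf (edge_side2 eE)).
rewrite /vote /wt /blocks -surjective_pairing eE !prefers_assignmentN //.
by do 2!case: prefers_to_assignment.
Qed.

(** An unmatched node never prefers its assignment, which excludes the value -2. *)
Lemma wt_unmatched1 e : e.1 \in unmatched M -> 0 <= wt G M e.1 e.2.
Proof.
rewrite inE /wt /prefers_assignment => /eqP ->.
by case: ifP.
Qed.

Lemma wt_unmatched2 e : e.2 \in unmatched M -> 0 <= wt G M e.1 e.2.
Proof.
rewrite inE /wt /prefers_assignment => /eqP ->.
by rewrite andbF; case: ifP.
Qed.

(** Votes are summed over all nodes. A node unmatched in [N] votes for [M] exactly when [M] matches
    it; the other nodes are grouped along the edges of [N], where [vote_wt] applies. *)
Lemma Delta_wt N : is_matching G N ->
  Delta G M N = #|unmatched N :\: unmatched M|%:Z - \sum_(e in N) wt G M e.1 e.2.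
Proof.
move=> hN; pose v u := (prefers_matching G u M N)%:Z - (prefers_matching G u N M)%:Z.
have -> : Delta G M N = \sum_u v u.
  have card_sum (P : pred V) : #|[set u | P u]|%:Z = \sum_u (P u)%:Z.
    rewrite -sum1dep_card big_mkcond (big_morph Posz PoszD erefl) /=.
    by apply: eq_bigr => u _; case: (P u).
  by rewrite /v sumrB -!card_sum.
rewrite (bigID [in unmatched N]) /=; congr (_ + _).
  rewrite -sum1_card (big_morph Posz PoszD erefl) big_mkcond [RHS]big_mkcond /=.
  apply: eq_bigr => u _; rewrite /v /prefers_matching !inE andbC.
  by case: (partner N u) => [w|] /=; case: (partner M u).
transitivity (\sum_(u in ~: unmatched N) v u).
  by apply: eq_bigl => u; rewrite in_setC.
rewrite (sum_matched hN) -sumrN; apply: eq_bigr => e eN.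
rewrite -vote_wt ?(matching_edge hN) // opprD.
by rewrite /v /vote /prefers_matching !opprB (partner1 hN eN) (partner2 hN eN).
Qed.

End Votes.

(** * Exchanging edges of a matching *)

Section Exchange.
Variables (V : finType) (G : pref_bigraph V) (M : {set V * V}).
Variables (xs : seq V) (es : seq (V * V)).
Implicit Types (e f : V * V).
Let U := unmatched M.
Hypothesis hM : is_matching G M.
Hypothesis xsA : {subset xs <= sideA G :\: U}.
Hypothesis esE : {subset es <= edges G}.
Hypotheses (uniq1 : uniq (map fst es)) (uniq2 : uniq (map snd es)).
Hypothesis es1 : forall e, e \in es -> e.1 \in xs \/ e.1 \in U.
Hypothesis es2 : forall e, e \in es -> e.2 \in map (mate M) xs \/ e.2 \in U.

(** One construction covers cycles, both kinds of exchange paths, augmenting paths and single free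
    edges: every new edge joins nodes that are freed by dropping the edges at [xs] or were unmatched
    before. *)
Definition exchange : {set V * V} := [set e in M | e.1 \notin xs] :|: [set e in es].

Lemma exchange_neq1 e f : e \in M -> e.1 \notin xs -> f \in es -> e.1 <> f.1.
Proof.
move=> eM exs fs ef; case: (es1 fs); rewrite -ef; first exact/negP.
exact/negP/matched1.
Qed.

Lemma exchange_neq2 e f : e \in M -> e.1 \notin xs -> f \in es -> e.2 <> f.2.
Proof.
move=> eM /negP exs fs ef; case: (es2 fs); rewrite -ef; last exact/negP/matched2.
case/mapP=> x xx ex; apply: exs; have xM := mateA hM (xsA xx).
by rewrite (matching_inj2 hM eM xM).
Qed.

Lemma exchange_matching : is_matching G exchange.
Proof.
apply: is_matchingI.
- apply/subsetP => e; rewrite !inE => /orP[/andP[eM _]|]; last exact: esE.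
  exact: (matching_edge hM).
- move=> e f; rewrite !inE => /orP[/andP[eM ex]|es_e] /orP[/andP[fM fx]|es_f] ef.
  + exact: (matching_inj1 hM).
  + by case: (exchange_neq1 eM ex es_f).
  + by case: (exchange_neq1 fM fx es_e).
  + exact: (uniq_map_inj uniq1).
- move=> e f; rewrite !inE => /orP[/andP[eM ex]|es_e] /orP[/andP[fM fx]|es_f] ef.
  + exact: (matching_inj2 hM).
  + by case: (exchange_neq2 eM ex es_f).
  + by case: (exchange_neq2 fM fx es_e).
  + exact: (uniq_map_inj uniq2).
Qed.

Lemma exchange_disjoint : [disjoint [set e in M | e.1 \notin xs] & [set e in es]].
Proof.
rewrite disjoints_subset; apply/subsetP => e; rewrite !inE => /andP[eM ex].
by apply/negP => /(exchange_neq1 eM ex).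
Qed.

(** Exactly [size es] edges arrive, and at most [size xs] leave, since edges of [M] have distinct
    first endpoints. *)
Lemma exchange_card : (#|M| + size es <= #|exchange| + size xs)%N.
Proof.
rewrite cardsU (eqP (_ : _ :&: _ == set0)) ?setI_eq0 ?exchange_disjoint //.
rewrite cards0 subn0 [#|[set e in es]|]cardsE (card_uniqP (map_uniq uniq1)).
have -> : #|M| = (#|[set e in M | e.1 \notin xs]| + #|[set e in M | e.1 \in xs]|)%N.
  rewrite -(cardsID [set e | e.1 \notin xs] M); congr (_ + _)%N; apply: eq_card => e.
    by rewrite !inE.
  by rewrite !inE negbK andbC.
rewrite addnAC leq_add2l.
rewrite -(card_in_imset (f := fst)); last first.
  by move=> e f; rewrite !inE => /andP[eM _] /andP[fM _]; apply: (matching_inj1 hM).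
apply: leq_trans (card_size xs); apply: subset_leq_card; apply/subsetP => x.
by case/imsetP => e; rewrite inE => /andP[_ ex] ->.
Qed.

Lemma max_exchange : is_max_matching G M -> (size es <= size xs)%N.
Proof.
case=> _ /(_ _ exchange_matching) leM; rewrite -(leq_add2l #|M|).
by apply: leq_trans exchange_card _; rewrite leq_add2r.
Qed.

(* [F] must contain every node that the exchange leaves unmatched. *)
Lemma popular_exchange (F : {set V}) : popular_max_matching G M ->
    size es = size xs ->
    {in xs, forall x, x \notin F -> x \in map fst es} ->
    {in xs, forall x, mate M x \notin F -> mate M x \in map snd es} ->
  \sum_(e <- es) wt G M e.1 e.2 <= #|F|%:Z.
Proof.
move=> [hmax pop] sz F1 F2.
have Nmax : is_max_matching G exchange.
  split=> [|N /(hmax.2) leN]; first exact: exchange_matching.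
  apply: leq_trans leN _; rewrite -(leq_add2r (size xs)) -{1}sz.
  exact: exchange_card.
have := pop _ Nmax; rewrite (Delta_wt hM Nmax.1).
(* The edges kept from [M] have weight 0. *)
have -> : \sum_(e in exchange) wt G M e.1 e.2 = \sum_(e <- es) wt G M e.1 e.2.
  rewrite (bigID [in es]) /= [X in _ + X]big1 ?addr0 => [|e]; last first.
    by rewrite !inE => /andP[/orP[/andP[eM _] _|->//]]; apply: (wt_matching hM).
  rewrite big_uniq ?(map_uniq uniq1) //=; apply: eq_bigl => e.
  by rewrite !inE; case: (e \in es); rewrite ?orbT ?andbF.
(* It remains to see that a node losing its partner lies in [F]: its edge of [M] was dropped, and
   outside [F] such a node is covered by [es]. *)
suff : (#|unmatched exchange :\: unmatched M| <= #|F|)%N by lia.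
apply: subset_leq_card; apply/subsetP => u /setDP[uN uM].
have nN e : e \in exchange -> ~~ incident u e.
  by move=> eN; apply: contraL uN => ue; apply/matchedP; exists e.
have /matchedP[e eM ue] := uM.
apply: contraT => uF.
have [ex|ex] := boolP (e.1 \in xs); last first.
  by have := nN e; rewrite ue !inE eM ex => /(_ isT).
suff [f fs uf] : exists2 f, f \in es & incident u f.
  by have := nN f; rewrite uf !inE fs orbT => /(_ isT).
case/orP: ue => /eqP ue.
  have := F1 _ ex; rewrite -ue uF => /(_ isT)/mapP[f fs uf].
  by exists f; rewrite // /incident uf eqxx.
have := F2 _ ex; rewrite (mate1 hM eM) -ue uF => /(_ isT)/mapP[f fs uf].
by exists f; rewrite // /incident uf eqxx orbT.
Qed.

End Exchange.

(** * Alternating paths *)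

Section AlternatingPaths.
Variables (V : finType) (G : pref_bigraph V) (M : {set V * V}).
Hypothesis hM : is_matching G M.
Implicit Types (a b x : V) (q : seq V) (e : V * V).
Let A' := sideA G :\: unmatched M.

Definition alt_arc a a' := [&& a \in A', a' \in A' & (a, mate M a') \in edges G].

(** Halving gives arcs of weight at most 1, hence a potential below $n_0$. Integrality also pays for
    one lost vote: $2w\le 1$ implies $w\le 0$. *)
Definition half_wt a b : int :=
  if blocks G M a b then 1
  else if prefers_assignment G M a b && prefers_assignment G M b a then -1 else 0.

Lemma wt_half a b : wt G M a b = 2 * half_wt a b.
Proof. by rewrite /wt /half_wt; case: ifP => // _; case: ifP. Qed.

Definition alt_weight a a' : int := half_wt a (mate M a').

Lemma alt_weight_le1 a a' : alt_weight a a' <= 1.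
Proof. by rewrite /alt_weight /half_wt; case: ifP => // _; case: ifP. Qed.

(** These are the edges outside [M] of the alternating path; its edges of [M] join each vertex to
    its mate. *)
Definition alt_edges x q : seq (V * V) := pairmap (fun a a' => (a, mate M a')) x q.

Lemma alt_edges_fst x q : map fst (alt_edges x q) = belast x q.
Proof. by elim: q x => //= y q IH x; rewrite IH. Qed.

Lemma alt_edges_snd x q : map snd (alt_edges x q) = map (mate M) q.
Proof. by elim: q x => //= y q IH x; rewrite IH. Qed.

Lemma alt_edges_wt x q :
  \sum_(e <- alt_edges x q) wt G M e.1 e.2 = 2 * path_weight alt_weight x q.
Proof.
elim: q x => [|y q IH] x; first by rewrite path_weight_nil mulr0 big_nil.
by rewrite path_weight_cons /= big_cons IH wt_half mulrDr.
Qed.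

Lemma mate_inj : {in A' &, injective (mate M)}.
Proof.
move=> a a' aA aA' eqm.
by have [] := matching_inj2 hM (mateA hM aA) (mateA hM aA') eqm.
Qed.

Lemma mate_matched a : a \in A' -> mate M a \notin unmatched M.
Proof. by move=> /(mateA hM)/matched2. Qed.

Section OnePath.
Variables (x : V) (q : seq V).
Hypotheses (xA : x \in A') (sp : simple_path alt_arc x q).

Lemma alt_path_sub : {subset x :: q <= A'}.
Proof.
move=> y; rewrite inE => /predU1P[->//|]; have /andP[+ _] := sp.
elim: q x => //= z r IH w /andP[/and3P[_ zA _] pr].
by rewrite inE => /predU1P[->//|]; apply: IH pr.
Qed.

Lemma alt_edges_sub : {subset alt_edges x q <= edges G}.
Proof.
have /andP[+ _] := sp; elim: q x => //= z r IH w /andP[/and3P[_ _ wz] pr] e.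
by rewrite inE => /predU1P[->//|]; apply: IH pr _.
Qed.

Lemma alt_path_uniq_mate : uniq (map (mate M) (x :: q)).
Proof.
rewrite map_inj_in_uniq; first by case/andP: sp.
by move=> y z /alt_path_sub yA /alt_path_sub zA; apply: mate_inj.
Qed.

Lemma alt_path_mate_matched b : b \in map (mate M) (x :: q) -> b \notin unmatched M.
Proof. by case/mapP=> y /alt_path_sub yA ->; apply: mate_matched. Qed.

Lemma alt_path_matched a : a \in x :: q -> a \notin unmatched M.
Proof. by case/alt_path_sub/setDP. Qed.

(** Exchanging along the closed cycle leaves no node newly unmatched, so [popular_exchange] applies
    with empty [F]. *)
Lemma alt_cycle_le0 : popular_max_matching G M -> alt_arc (last x q) x ->
  path_weight alt_weight x q + alt_weight (last x q) x <= 0.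
Proof.
move=> pop /and3P[_ _ lx]; pose es := rcons (alt_edges x q) (last x q, mate M x).
have es_fst : map fst es = x :: q by rewrite map_rcons alt_edges_fst -lastI.
have es_snd : map snd es =i map (mate M) (x :: q).
  by move=> b; rewrite map_rcons alt_edges_snd mem_rcons.
have : \sum_(e <- es) wt G M e.1 e.2 <= #|set0 : {set V}|%:Z.
  apply: (popular_exchange (xs := x :: q)) => //.
  - exact: alt_path_sub.
  - by move=> e; rewrite mem_rcons inE => /predU1P[->//|]; apply: alt_edges_sub.
  - by rewrite es_fst; case/andP: sp.
  - by rewrite map_rcons alt_edges_snd rcons_uniq; apply: alt_path_uniq_mate.
  - by move=> e /(map_f fst); rewrite es_fst; left.
  - by move=> e /(map_f snd); rewrite es_snd; left.
  - by rewrite size_rcons size_pairmap.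
  - by move=> y; rewrite es_fst.
  - by move=> y yq _; rewrite es_snd map_f.
rewrite big_rcons /= alt_edges_wt wt_half cards0 /alt_weight; lia.
Qed.

(** The exchange matches [b] and abandons only [mate M x]. The edge to [b] has nonnegative weight,
    so twice the path weight is at most 1. *)
Lemma alt_path_to_unmatched_le0 b : popular_max_matching G M ->
    b \in unmatched M -> (last x q, b) \in edges G ->
  path_weight alt_weight x q <= 0.
Proof.
move=> pop bU lb; pose es := rcons (alt_edges x q) (last x q, b).
have es_fst : map fst es = x :: q by rewrite map_rcons alt_edges_fst -lastI.
have es_snd : map snd es = rcons (map (mate M) q) b by rewrite map_rcons alt_edges_snd.
have := alt_path_uniq_mate; rewrite map_cons cons_uniq => /andP[_ um].
have : \sum_(e <- es) wt G M e.1 e.2 <= #|[set mate M x]|%:Z.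
  apply: (popular_exchange (xs := x :: q)) => //.
  - exact: alt_path_sub.
  - by move=> e; rewrite mem_rcons inE => /predU1P[->//|]; apply: alt_edges_sub.
  - by rewrite es_fst; case/andP: sp.
  - rewrite es_snd rcons_uniq um andbT; apply: contraL bU => bq.
    by apply: alt_path_mate_matched; rewrite /= inE bq orbT.
  - by move=> e /(map_f fst); rewrite es_fst; left.
  - move=> e /(map_f snd); rewrite es_snd mem_rcons inE => /predU1P[->|eq].
      by right.
    by left; rewrite /= inE eq orbT.
  - by rewrite size_rcons size_pairmap.
  - by move=> y; rewrite es_fst.
  - move=> y; rewrite inE => /predU1P[->|yq _]; first by rewrite eqxx.
    by rewrite es_snd mem_rcons inE map_f ?orbT.
have := @wt_unmatched2 _ G M (last x q, b) bU.
by rewrite big_rcons /= alt_edges_wt cards1; lia.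
Qed.

(** Here [a] takes over the mate of [x], and only the last vertex of the path is abandoned. *)
Lemma alt_path_from_unmatched_le0 a : popular_max_matching G M ->
    a \in unmatched M -> (a, mate M x) \in edges G ->
  path_weight alt_weight x q <= 0.
Proof.
move=> pop aU ax; pose es := (a, mate M x) :: alt_edges x q.
have es_fst : map fst es = a :: belast x q by rewrite /= alt_edges_fst.
have es_snd : map snd es = map (mate M) (x :: q) by rewrite /= alt_edges_snd.
have sub : {subset belast x q <= x :: q}.
  by move=> y yq; rewrite lastI mem_rcons inE yq orbT.
have : \sum_(e <- es) wt G M e.1 e.2 <= #|[set last x q]|%:Z.
  apply: (popular_exchange (xs := x :: q)) => //.
  - exact: alt_path_sub.
  - by move=> e; rewrite inE => /predU1P[->//|]; apply: alt_edges_sub.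
  - rewrite es_fst /=; have /andP[_] := sp; rewrite lastI rcons_uniq => /andP[_ ->].
    by rewrite andbT; apply: contraL aU => /sub; apply: alt_path_matched.
  - by rewrite es_snd; apply: alt_path_uniq_mate.
  - move=> e /(map_f fst); rewrite es_fst inE => /predU1P[->|/sub]; by [right|left].
  - by move=> e /(map_f snd); rewrite es_snd; left.
  - by rewrite /= size_pairmap.
  - move=> y; rewrite lastI mem_rcons inE => /predU1P[->|yq _].
      by rewrite inE eqxx.
    by rewrite es_fst inE yq orbT.
  - by move=> y yq _; rewrite es_snd map_f.
have := @wt_unmatched1 _ G M (a, mate M x) aU.
by rewrite big_cons /= alt_edges_wt cards1; lia.
Qed.

(** With both end edges added, the exchange gains one edge more than it drops. *)
Lemma no_augmenting_path a b : is_max_matching G M ->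
    a \in unmatched M -> (a, mate M x) \in edges G ->
    b \in unmatched M -> (last x q, b) \in edges G -> False.
Proof.
move=> hmax aU ax bU lb.
pose es := (a, mate M x) :: rcons (alt_edges x q) (last x q, b).
have es_fst : map fst es = a :: x :: q by rewrite /= map_rcons alt_edges_fst -lastI.
have es_snd : map snd es = rcons (map (mate M) (x :: q)) b.
  by rewrite /= map_rcons alt_edges_snd.
suff : (size es <= size (x :: q))%N by rewrite /= size_rcons size_pairmap ltnn.
apply: (max_exchange hM) => //.
- exact: alt_path_sub.
- move=> e; rewrite inE => /predU1P[->//|].
  by rewrite mem_rcons inE => /predU1P[->//|]; apply: alt_edges_sub.
- rewrite es_fst cons_uniq; case/andP: sp => _ ->; rewrite andbT.
  by apply: contraL aU; apply: alt_path_matched.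
- rewrite es_snd rcons_uniq alt_path_uniq_mate andbT.
  by apply: contraL bU; apply: alt_path_mate_matched.
- move=> e /(map_f fst); rewrite es_fst inE => /predU1P[->|]; by [right|left].
- move=> e /(map_f snd); rewrite es_snd mem_rcons inE => /predU1P[->|]; by [right|left].
Qed.

End OnePath.

Lemma max_matching_no_free_edge e : is_max_matching G M -> e \in edges G ->
  e.1 \in unmatched M -> e.2 \in unmatched M -> False.
Proof.
move=> hmax eE e1 e2.
suff : (size [:: e] <= size (Nil V))%N by [].
by apply: (max_exchange hM) => // [f|f|f]; rewrite inE => /eqP-> //; right.
Qed.

End AlternatingPaths.

(** * The optimal dual solution *)

Theorem theorem5 (R : realFieldType) (V : finType) (G : pref_bigraph V)
    (M : {set V * V}) (hM : popular_max_matching G M) :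
  let U := unmatched M in
  let U_A := U :&: sideA G in
  let U_B := U :&: sideB G in
  let A' := sideA G :\: U in
  let B' := sideB G :\: U in
  let n0 := #|A'| in
  exists alpha : V -> R,
    [/\ lp_optimal G M alpha,
        forall a, a \in A' -> exists2 k : nat, (k < n0)%N & alpha a = - (2 * k)%:R,
        forall b, b \in B' -> exists2 k : nat, (k < n0)%N & alpha b = (2 * k)%:R,
        forall a, a \in Nbr G U_B -> alpha a = 0
      & forall b, b \in Nbr G U_A -> alpha b = (2 * (n0 - 1))%:R].
Proof.
move=> U U_A U_B A' B' n0; have hmax := hM.1; have hm := hmax.1.
have NbrB a : a \in Nbr G U_B -> exists2 b, b \in U & (a, b) \in edges G.
  rewrite inE => /exists_inP[b]; rewrite !inE => /andP[bU bA] /orP[] ab.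
    by rewrite (edge_side1 ab) in bA.
  by exists b; rewrite ?inE.
have NbrA b : b \in Nbr G U_A -> exists2 a, a \in U & (a, b) \in edges G.
  rewrite inE => /exists_inP[a]; rewrite !inE => /andP[aU aA] /orP[] ab.
    by exists a; rewrite ?inE.
  by have := edge_side2 ab; rewrite /= aA.
(* An unmatched neighbor of an unmatched node would give a free edge, against maximality. *)
have NbrB_A a : a \in Nbr G U_B -> a \in A'.
  case/NbrB=> b bU ab; rewrite inE (edge_side1 ab) andbT.
  by apply/negP => aU; apply: (max_matching_no_free_edge hm hmax ab).
have NbrA_B b : b \in Nbr G U_A -> b \in B'.
  case/NbrA=> a aU ab; rewrite inE [b \in sideB G]inE (edge_side2 ab) andbT.
  by apply/negP => bU; apply: (max_matching_no_free_edge hm hmax ab).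
have mB b : b \in B' -> mate M b \in A' /\ mate M (mate M b) = b.
  move/(mateB hm) => bM; split; last exact: (mate1 hm bM).
  by rewrite inE (matched1 bM) (edge_side1 (matching_edge hm bM)).
pose S1 := [set a in A' | mate M a \in Nbr G U_A].
have S1A a : a \in S1 -> exists2 a0, a0 \in U & (a0, mate M a) \in edges G.
  by rewrite inE => /andP[_ /NbrA].
have [|||||||p [p_lt p_arc p_S1 p_S0]] := @longest_path_potential V A' (Nbr G U_B) S1
  (alt_arc G M) (alt_weight G M) (@alt_weight_le1 V G M).
- by move=> x y /and3P[-> ->].
- by move=> x q sp lx; apply: alt_cycle_le0 => //; case/and3P: lx.
- move=> x q xS1 sp; have [a aU ax] := S1A _ xS1.
  by apply: (alt_path_from_unmatched_le0 _ _ sp) ax => //; case/setIdP: xS1.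
- move=> x q xA /NbrB[b bU lb] sp.
  exact: (alt_path_to_unmatched_le0 _ _ sp) lb.
- move=> x q xS1 sp; apply/negP => /NbrB[b bU lb]; have [a aU ax] := S1A _ xS1.
  by apply: (no_augmenting_path _ _ sp hmax aU ax bU lb) => //; case/setIdP: xS1.
- by apply/subsetP => a; apply: NbrB_A.
- by apply/subsetP => a /setIdP[].
(* The opposite signs make the two values cancel on every edge of [M]; the factor 2 undoes the
   halving of the weights. *)
pose alpha u : R := if u \in sideA G then - (2 * p u)%:R else (2 * p (mate M u))%:R.
have alphaA a : a \in sideA G -> alpha a = - (2 * p a)%:R by rewrite /alpha => ->.
have alphaB b : b \notin sideA G -> alpha b = (2 * p (mate M b))%:R.
  by rewrite /alpha => /negPf->.
have objective y : lp_objective M y = \sum_(e in M) (y e.1 + y e.2) :> R.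
  exact: (sum_matched hm).
exists alpha; split.
- split=> [a b|z zf].
    rewrite inE /= !in_setC => /and3P[ab aU bU].
    have aA := edge_side1 ab; have bA := edge_side2 ab.
    have [|bA' mb] := mB b; first by rewrite inE bU inE.
    (* The constraint on (a, b) is twice the potential inequality on the arc from [a] to the partner
       of [b]. *)
    have : alt_arc G M a (mate M b) by rewrite /alt_arc bA' mb ab in_setD aU aA.
    move/p_arc; rewrite /alt_weight mb alphaA // alphaB // wt_half => le_p.
    have {le_p} : 2 * half_wt G M a b <= (2 * p (mate M b))%N%:Z - (2 * p a)%N%:Z by lia.
    by rewrite -(ler_int R) rmorphB addrC.
  (* Grouped along [M], the objective of [alpha] has zero terms, while feasibility of [z] on the
     edges of [M], where [wt] is 0, makes its terms nonnegative. *)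
  rewrite !objective; apply: ler_sum => e eM.
  have eE := matching_edge hm eM.
  rewrite alphaA ?edge_side1 // alphaB ?edge_side2 // (mate2 hm eM) addNr.
  have := zf e.1 e.2; rewrite (wt_matching hm eM); apply.
  by rewrite inE -surjective_pairing eE !in_setC matched1 // matched2.
- move=> a aA'; exists (p a); first exact: p_lt.
  by rewrite alphaA //; case/setDP: aA'.
- move=> b bB'; have [mA _] := mB _ bB'; exists (p (mate M b)); first exact: p_lt.
  by rewrite alphaB //; case/setDP: bB'; rewrite inE.
- move=> a aN; have /setDP[aA _] := NbrB_A _ aN.
  by rewrite alphaA // p_S0 // muln0 oppr0.
- move=> b bN; have bB' := NbrA_B _ bN; have [mA mb] := mB _ bB'.
  rewrite alphaB; last by case/setDP: bB'; rewrite inE.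
  by rewrite p_S1 ?subn1 // inE mA mb.
Qed.
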